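(* Let $\mathfrak p\subset\mathfrak{gl}(V,V_* )$ be a subalgebra such that $\mathfrak p=(\mathfrak n_{\mathfrak p})^\perp$, the orthogonal complement in $\mathfrak{gl}(V,V_* )$ of the linear nilradical of $\mathfrak p$ with respect to the form $(X,Y)\mapsto\mathrm{tr}(XY)$. Then $\mathfrak p$ is a parabolic subalgebra of $\mathfrak{gl}(V,V_* )$.
   Context: $V,V_*$: countable-dimensional complex spaces with nondegenerate pairing; $\mathfrak{gl}(V,V_* )$ is the Lie algebra of $V\otimes V_*$ with product $(v\otimes w)(v'\otimes w')=\langle v',w\rangle v\otimes w'$; its elements are finite-rank endomorphisms of $V$, and $\mathrm{tr}$ is the trace ($\mathrm{tr}(v\otimes w)=\langle v,w\rangle$). Linear nilradical $\mathfrak n_{\mathfrak p}$: elements of the largest locally solvable ideal of $\mathfrak p$ that are nilpotent endomorphisms of $V$. Borel subalgebra: maximal locally solvable subalgebra; parabolic subalgebra: subalgebra containing a Borel subalgebra. *)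

(* Defs.v *)
From HB Require Import structures.
From mathcomp Require Import all_boot all_order all_algebra.
From Stdlib Require Import ClassicalEpsilon.
Set Implicit Arguments. Unset Strict Implicit. Unset Printing Implicit Defensive.
Import Order.TTheory GRing.Theory Num.Theory.
Local Open Scope ring_scope.

Section GL.
Variables (F : numClosedFieldType) (V Vs : lmodType F).

Definition bilinear_pairing (pr : V -> Vs -> F) : Prop :=
  (forall (a : F) v1 v2 w, pr (a *: v1 + v2) w = a * pr v1 w + pr v2 w) /\
  (forall (a : F) v w1 w2, pr v (a *: w1 + w2) = a * pr v w1 + pr v w2).

Definition nondeg_pairing (pr : V -> Vs -> F) : Prop :=
  (forall v, (forall w, pr v w = 0) -> v = 0) /\
  (forall w, (forall v, pr v w = 0) -> w = 0).

Definition countable_dim (U : lmodType F) : Prop :=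
  exists e : nat -> U,
    (forall (n : nat) (c : nat -> F),
        \sum_(i < n) c i *: e i = 0 -> forall i, (i < n)%N -> c i = 0) /\
    (forall u, exists (n : nat) (c : nat -> F), u = \sum_(i < n) c i *: e i).

Definition endo := V -> V.

Variable pr : V -> Vs -> F.

(* gl(V,V_* ) = V (x) V_* realised as finite-rank endomorphisms:
   (v (x) w)(x) = <x,w> v *)
Definition in_gl (X : endo) : Prop :=
  exists (n : nat) (v : 'I_n -> V) (w : 'I_n -> Vs),
    forall x, X x = \sum_(i < n) pr x (w i) *: v i.

Definition has_trace (X : endo) (t : F) : Prop :=
  exists (n : nat) (v : 'I_n -> V) (w : 'I_n -> Vs),
    (forall x, X x = \sum_(i < n) pr x (w i) *: v i) /\
    t = \sum_(i < n) pr (v i) (w i).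

Definition tr (X : endo) : F := epsilon (inhabits 0) (has_trace X).

Definition comp (X Y : endo) : endo := fun x => X (Y x).
Definition bracket (X Y : endo) : endo := fun x => X (Y x) - Y (X x).

Definition is_subspace (M : endo -> Prop) : Prop :=
  M (fun _ => 0) /\
  (forall X Y, M X -> M Y -> M (fun x => X x + Y x)) /\
  (forall (a : F) X, M X -> M (fun x => a *: X x)).

Definition is_subalgebra (M : endo -> Prop) : Prop :=
  (forall X, M X -> in_gl X) /\ is_subspace M /\
  (forall X Y, M X -> M Y -> M (bracket X Y)).

Definition subset (M N : endo -> Prop) : Prop := forall X, M X -> N X.

Definition gen_subalg (n : nat) (f : 'I_n -> endo) (X : endo) : Prop :=
  forall M, is_subalgebra M -> (forall i, M (f i)) -> M X.

Definition derived (L : endo -> Prop) (X : endo) : Prop :=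
  forall M, is_subspace M -> (forall a b, L a -> L b -> M (bracket a b)) -> M X.

Fixpoint derser (L : endo -> Prop) (k : nat) : endo -> Prop :=
  match k with 0 => L | k'.+1 => derived (derser L k') end.

Definition solvable (L : endo -> Prop) : Prop :=
  exists k, forall X, derser L k X -> forall x, X x = 0.

Definition locally_solvable (L : endo -> Prop) : Prop :=
  forall (n : nat) (f : 'I_n -> endo), (forall i, L (f i)) -> solvable (gen_subalg f).

Definition is_ideal (p I : endo -> Prop) : Prop :=
  is_subspace I /\ subset I p /\ (forall X Y, p X -> I Y -> I (bracket X Y)).

(* largest locally solvable ideal = union of all locally solvable ideals *)
Definition loc_solv_radical (p : endo -> Prop) (X : endo) : Prop :=
  exists I, is_ideal p I /\ locally_solvable I /\ I X.

Definition nilpotent_endo (X : endo) : Prop := exists k, forall x, iter k X x = 0.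

Definition linear_nilradical (p : endo -> Prop) (X : endo) : Prop :=
  loc_solv_radical p X /\ nilpotent_endo X.

Definition orth (N : endo -> Prop) (X : endo) : Prop :=
  in_gl X /\ forall Y, N Y -> tr (comp X Y) = 0.

Definition is_borel (B : endo -> Prop) : Prop :=
  is_subalgebra B /\ locally_solvable B /\
  (forall B', is_subalgebra B' -> locally_solvable B' -> subset B B' -> subset B' B).

Definition is_parabolic (p : endo -> Prop) : Prop :=
  is_subalgebra p /\ exists B, is_borel B /\ subset B p.

End GL.

(* Main.v *)
Require Import Defs.
From mathcomp Require Import all_boot all_order all_algebra.
From mathcomp Require Import boolp zify.
From mathcomp Require classical_sets.
From Stdlib Require ClassicalEpsilon.
Set Implicit Arguments. Unset Strict Implicit. Unset Printing Implicit Defensive.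
Import GRing.Theory Num.Theory.
Local Open Scope ring_scope.

(** Let [B] be a maximal locally solvable subalgebra of [p] (Zorn).  If [I] is
    a locally solvable ideal of [p], then [B + I] is again locally solvable,
    because [gl(V, V_* )] is locally finite; hence [B] contains the linear
    nilradical.  If [B'] is a locally solvable subalgebra of [gl(V, V_* )]
    containing [B], then by Lie's theorem any [X] in [B'] and any [Y] in the
    nilradical are simultaneously triangular with [Y] strictly so, whence
    [tr (X Y) = 0].  Thus [B'] lies in the orthogonal of the nilradical, which
    is [p], and [B' = B] by maximality: [B] is a Borel subalgebra. *)

(** * Solvable Lie algebras of matrices *)

(** A row space of maximal rank inside [P] is all of [P], because adjoining a vector of [P] cannot
    raise the rank. This brings rank arguments to subspaces given as mere predicates. *)
Lemma subspace_mx (F : fieldType) (n : nat) (P : 'rV[F]_n -> Prop) :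
  P 0 -> (forall a u v, P u -> P v -> P (a *: u + v)) ->
  exists U : 'M_n, forall v, P v <-> (v <= U)%MS.
Proof.
move=> P0 PD.
pose Q k := exists2 U : 'M[F]_n, \rank U = k & forall v, (v <= U)%MS -> P v.
have exQ : exists k, `[< Q k >].
  exists 0%N; apply/asboolP; exists 0; first by rewrite mxrank0.
  by move=> v; rewrite submx0 => /eqP ->.
have leQ k : `[< Q k >] -> (k <= n)%N.
  by case/asboolP=> U <- _; exact: rank_leq_col.
case: (ex_maxnP exQ leQ) => k /asboolP[U rU UP] kmax.
exists U => v; split=> [Pv|]; last exact: UP.
have vUP w : (w <= v + U)%MS -> P w.
  case/sub_addsmxP=> -[a b] /= ->.
  rewrite [a]mx11_scalar mul_scalar_mx; apply: PD => //.
  by apply: UP; exact: submxMl.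
have : (\rank (v + U)%MS <= \rank U)%N.
  by rewrite rU; apply: kmax; apply/asboolP; exists (v + U)%MS.
rewrite (geq_leqif (mxrank_leqif_sup (addsmxSr v U))).
by apply: submx_trans; exact: addsmxSl.
Qed.

(** Let [U] be a nonzero subspace of minimal rank stable under [N]. By commutativity [U *m c] is
    stable too, so if nonzero it equals [U]; then [U] equals [U *m c ^+ m], which is zero for large
    [m]. Hence every [c] in [N] kills [U]. *)
Lemma commuting_nilpotents_kernel (F : fieldType) (n : nat)
    (N : 'M[F]_n -> Prop) :
  (0 < n)%N -> (forall c, N c -> exists m, c ^+ m = 0) ->
  (forall c d, N c -> N d -> c *m d = d *m c) ->
  exists2 v : 'rV_n, v != 0 & forall c, N c -> v *m c = 0.
Proof.
move=> n0 nilN commN.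
pose Q k := (0 < k)%N /\ exists2 U : 'M[F]_n, \rank U = k &
  forall c, N c -> stablemx U c.
have exQ : exists k, `[< Q k >].
  exists n; apply/asboolP; split=> //; exists 1%:M; first by rewrite mxrank1.
  by move=> c _; exact: submx1.
case: (ex_minnP exQ) => k /asboolP[k0 [U rU sU]] kmin.
have UN c : N c -> U *m c = 0.
  move=> Nc; apply/eqP; rewrite -mxrank_eq0 -leqn0 leqNgt; apply/negP=> Uc0.
  have : (\rank U <= \rank (U *m c))%N.
    rewrite rU; apply: kmin; apply/asboolP; split=> //.
    exists (U *m c) => // d Nd.
    by rewrite -mulmxA (commN c d) // mulmxA submxMr // sU.
  rewrite (geq_leqif (mxrank_leqif_sup (sU c Nc))) => UUc.
  have UcX m : (U <= U *m c ^+ m)%MS.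
    elim: m => [|m IH]; first by rewrite expr0 mulmx1.
    by apply: (submx_trans UUc); rewrite exprSr mulmxA submxMr.
  have [m cm0] := nilN c Nc.
  move: (UcX m); rewrite cm0 mulmx0 submx0 => /eqP U0.
  by move: k0; rewrite -rU U0 mxrank0.
have /rowV0Pn[v vU v0] : U != 0 by rewrite -mxrank_eq0 rU -lt0n.
exists v => // c Nc; case/submxP: vU => w ->.
by rewrite -mulmxA UN // mulmx0.
Qed.

(* Bracketing [f(a) c^m = 0] with [x] and multiplying by [c] trades [f] for
   its derivative: [f'(a) c^(m+2) = 0].  Starting from the characteristic
   polynomial of [a], one reaches a nonzero constant in characteristic 0. *)
Lemma commutator_nilpotent (F : numFieldType) (n : nat) (a x : 'M[F]_n.+1) :
  let c := a * x - x * a in let d := c * x - x * c in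
  a * c = c * a -> c * d = d * c -> exists m, c ^+ m = 0.
Proof.
move=> c d ac cd.
have cE : c = a * x - x * a by []; have dE : d = c * x - x * c by [].
clearbody d; clearbody c.
have derE p : horner_mx a p * x - x * horner_mx a p = horner_mx a p^`() * c.
  elim/poly_ind: p => [|p k IH].
    by rewrite deriv0 rmorph0 !mul0r mulr0 subrr.
  rewrite derivMXaddC !rmorphD !rmorphM /= horner_mx_X horner_mx_C.
  rewrite [in RHS]mulrDl -[_ * a * c]mulrA ac [_ * (c * a)]mulrA -IH.
  have kx : k%:M * x = x * k%:M by apply/esym; exact: scalar_mxC.
  rewrite mulrDl kx mulrDr opprD addrACA subrr addr0.
  by rewrite {1}cE mulrBr mulrBl !mulrA addrA addrNK.
(* The derivation rule for [c ^+ m] involves the exponent [m - 1]; the extra factor [c] removes it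
   and makes [m = 0] uniform. *)
have powE m : (c ^+ m * x - x * c ^+ m) * c = c ^+ m * d *+ m.
  elim: m => [|m IH]; first by rewrite expr0 mul1r mulr1 subrr mul0r.
  have -> : c ^+ m.+1 * x - x * c ^+ m.+1 =
            c * (c ^+ m * x - x * c ^+ m) + d * c ^+ m.
    by rewrite dE mulrBr mulrBl !exprS !mulrA addrA addrNK.
  rewrite mulrDl -mulrA IH -mulrnAr mulrA -exprS -mulrA -exprSr.
  rewrite (_ : d * c ^+ m.+1 = c ^+ m.+1 * d); last first.
    by apply: commrX; rewrite /GRing.comm cd.
  by rewrite mulrnAr -mulrSr.
pose p := char_poly a.
have killE k : horner_mx a p^`(k) * c ^+ k.*2 = 0.
  elim: k => [|k IH]; first by rewrite derivn0 Cayley_Hamilton mul0r.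
  set A := horner_mx a _ in IH.
  have : (A * c ^+ k.*2 * x - x * (A * c ^+ k.*2)) * c = 0.
    by rewrite IH mul0r mulr0 subrr mul0r.
  have -> : A * c ^+ k.*2 * x - x * (A * c ^+ k.*2) =
    A * (c ^+ k.*2 * x - x * c ^+ k.*2) + (A * x - x * A) * c ^+ k.*2.
    by rewrite mulrBr mulrBl !mulrA addrA addrNK.
  rewrite mulrDl -mulrA powE mulrnAr mulrA IH mul0r mul0rn add0r derE.
  by rewrite derivnS doubleS -!mulrA -exprSr -exprS.
have pE : p^`(n.+1) = (n.+1)`!%:R%:P.
  apply/polyP=> -[|i]; rewrite coef_derivn coefC /=.
    have := char_poly_monic a; rewrite monicE /lead_coef size_char_poly /=.
    by move=> /eqP; rewrite addn0 -/p ffactnn => ->.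
  by rewrite nth_default ?mul0rn // size_char_poly addnS !ltnS leq_addr.
exists (n.+1).*2; move: (killE n.+1); rewrite pE horner_mx_C.
move=> /eqP; rewrite (_ : _ * _ = (n.+1)`!%:R *: c ^+ (n.+1).*2); last first.
  exact: mul_scalar_mx.
by rewrite scaler_eq0 pnatr_eq0 eqn0Ngt fact_gt0 => /orP[//|/eqP].
Qed.

(** [Q1] and [Q2] are the blocks of the inverse of the stacked bases of [U] and [U^C]. They serve to
    cut a representation stabilizing [U] into its restriction to [U] and the quotient by [U]. *)
Lemma complementary_projections (F : fieldType) (n : nat) (U : 'M[F]_n) :
  exists (P1 : 'M_(\rank U, n)) (Q1 : 'M_(n, \rank U))
         (P2 : 'M_(\rank U^C, n)) (Q2 : 'M_(n, \rank U^C)),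
  [/\ (P1 :=: U)%MS, Q1 *m P1 + Q2 *m P2 = 1%:M, P1 *m Q1 = 1%:M,
      P2 *m Q2 = 1%:M & P1 *m Q2 = 0].
Proof.
pose P1 := row_base U; pose P2 := row_base U^C%MS.
pose M := col_mx P1 P2; pose Q := pinvmx M.
have Mrank : \rank M = n.
  rewrite -addsmxE (adds_eqmx (eq_row_base _) (eq_row_base _)).
  by apply/eqP; exact: addsmx_compl_full.
have Mfull : row_full M by rewrite /row_full Mrank.
have Mfree : row_free M.
  by rewrite /row_free Mrank mxrank_compl subnKC ?rank_leq_col.
have QM : Q *m M = 1%:M by exact: mulVpmx.
have MQ : M *m Q = 1%:M by exact: mulmxVp.
exists P1, (lsubmx Q), P2, (rsubmx Q).
move: QM; rewrite -{1}[Q]hsubmxK mul_row_col => QM.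
move: MQ; rewrite -{1}[Q]hsubmxK mul_col_row scalar_mx_block.
move=> /eq_block_mx[]; split=> //; exact: eq_row_base.
Qed.

(* In the application [T] is a Lie algebra of endomorphisms with bracket [br],
   [D] its derived series, and [rho] a matrix representation killing [D k]. *)
Section LieTrace.
Variables (F : numClosedFieldType) (T : Type) (br : T -> T -> T).
Variables (D : nat -> T -> Prop) (k : nat).
Hypothesis D_br : forall i x y, D i x -> D i y -> D i.+1 (br x y).
Hypothesis D_ideal : forall i x y, D i x -> D 0%N y -> D i (br x y).
Hypothesis D_sub : forall i x, D i x -> D 0%N x.

Definition bracket_morphism n (rho : T -> 'M[F]_n) : Prop :=
  forall x y, D 0%N x -> D 0%N y ->
    rho (br x y) = rho x *m rho y - rho y *m rho x.

Definition irreducible_rep n (rho : T -> 'M[F]_n) : Prop :=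
  forall U : 'M_n, (forall x, D 0%N x -> stablemx U (rho x)) ->
    U = 0 \/ \rank U = n.

(** An eigenspace of [a], which exists over an algebraically closed field, is a nonzero
    subrepresentation, hence everything. *)
Lemma schur n (rho : T -> 'M[F]_n.+1) (a : 'M_n.+1) :
  irreducible_rep rho -> (forall x, D 0%N x -> a *m rho x = rho x *m a) ->
  exists l, a = l%:M.
Proof.
move=> irr comm_a; have [//|l al] := eigenvalue_closed a _.
exists l; case: (irr (eigenspace a l)) => [x Dx|E0|Efull].
- by apply: comm_mx_stable_eigenspace; exact: comm_a.
- by move: al; rewrite /eigenvalue E0 eqxx.
- have /sub_kermxP : (1%:M <= eigenspace a l)%MS.
    by rewrite sub1mx /row_full Efull.
  by rewrite mul1mx => /eqP; rewrite subr_eq0 => /eqP.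
Qed.

(** Since [D i] acts by commuting matrices, [commutator_nilpotent] makes each bracket of [D i] with
    the algebra act nilpotently. The common kernel of the nilpotent matrices from [D i] is a nonzero
    subrepresentation, hence everything, so these brackets act by zero. Thus [rho x] commutes with
    the whole image, and Schur's lemma applies. *)
Lemma abelian_ideal_scalar n (rho : T -> 'M[F]_n.+1) i :
  bracket_morphism rho -> irreducible_rep rho ->
  (forall x y, D i x -> D i y -> rho (br x y) = 0) ->
  forall x, D i x -> exists l, rho x = l%:M.
Proof.
move=> hom irr ab.
have comm x y : D i x -> D i y -> rho x *m rho y = rho y *m rho x.
  move=> Dx Dy; apply/eqP; rewrite -subr_eq0.
  by rewrite -(hom _ _ (D_sub Dx) (D_sub Dy)) ab.
have nil_br x y : D i x -> D 0%N y -> exists m, rho (br x y) ^+ m = 0.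
  move=> Dx Dy; have Dxy := D_ideal Dx Dy; have Dxyy := D_ideal Dxy Dy.
  rewrite (hom _ _ (D_sub Dx) Dy).
  apply: commutator_nilpotent; rewrite -[_ * _ - _ * _](hom _ _ (D_sub Dx) Dy).
    exact: comm.
  by rewrite -[rho _ * _ - _](hom _ _ (D_sub Dxy) Dy); exact: comm.
pose N c := exists x, [/\ D i x, c = rho x & exists m, c ^+ m = 0].
have nilN c : N c -> c = 0.
  move=> Nc.
  have [||v v0 vN] := @commuting_nilpotents_kernel F n.+1 N isT.
  - by move=> ? [? []].
  - by move=> ? ? [? [? -> _]] [? [? -> _]]; exact: comm.
  have [||K KP] := @subspace_mx F n.+1 (fun w => forall c, N c -> w *m c = 0).
  - by move=> ? _; rewrite mul0mx.
  - move=> a u w hu hw e Ne.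
    by rewrite mulmxDl -scalemxAl hu // hw // scaler0 addr0.
  case: (irr K) => [y Dy|K0|Kfull].
  - apply/rV_subP=> w /submxP[u ->]; apply/KP=> e [x [Dx -> nilx]].
    have Kc z : D i z -> (exists m, rho z ^+ m = 0) -> K *m rho z = 0.
      move=> Dz nz; apply/row_matrixP=> j; rewrite row_mul row0.
      by apply: (KP (row j K)).2; [exact: row_sub|exists z; split].
    (* Both [K *m rho (br x y)] and [K *m rho x] vanish, so the bracket relation leaves
       [K *m rho y *m rho x = 0]: the kernel is stable. *)
    have := hom _ _ (D_sub Dx) Dy => /(congr1 (mulmx K)).
    rewrite (Kc _ (D_ideal Dx Dy)) ?mulmxBr; last exact: nil_br.
    rewrite !mulmxA Kc // mul0mx sub0r => /eqP; rewrite eq_sym oppr_eq0.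
    by move=> /eqP KE; rewrite -!mulmxA [K *m _]mulmxA KE mulmx0.
  - have /KP : forall e, N e -> v *m e = 0 by [].
    by rewrite K0 submx0 (negPf v0).
  - apply/row_matrixP=> j; rewrite rowE row0; apply: (KP _).2 => //.
    by apply: submx_full; rewrite /row_full Kfull.
move=> x Dx; apply: schur irr _ => y Dy; apply/eqP.
rewrite -subr_eq0 -(hom _ _ (D_sub Dx) Dy).
apply/eqP/nilN; exists (br x y); split=> //; first exact: D_ideal.
exact: nil_br.
Qed.

(** Climbing the derived series from [D k] up to [D 0]: once [D (k - j)] acts by commuting matrices
    it acts by scalars, and a bracket of two elements one level up is such a scalar with trace zero,
    hence zero in characteristic 0. *)
Lemma irreducible_scalar n (rho : T -> 'M[F]_n.+1) :
  bracket_morphism rho -> irreducible_rep rho ->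
  (forall x, D k x -> rho x = 0) ->
  forall x, D 0%N x -> exists l, rho x = l%:M.
Proof.
move=> hom irr Dk0.
suff ab j : forall x y, D (k - j)%N x -> D (k - j)%N y -> rho (br x y) = 0.
  by apply: abelian_ideal_scalar => //; move: (ab k); rewrite subnn.
elim: j => [|j IH] x y.
  rewrite subn0 => Dx Dy.
  by rewrite (hom _ _ (D_sub Dx) (D_sub Dy)) !Dk0 // mul0mx subrr.
(* Truncated subtraction: once [j] reaches [k], both levels are [D 0]. *)
have [kj|jk] := leqP k j.
  have -> : (k - j.+1 = k - j)%N.
    by move: kj (leqW kj); rewrite /leq => /eqP -> /eqP ->.
  exact: IH.
move=> Dx Dy.
have Dxy : D (k - j) (br x y).
  by rewrite -(subnSK jk); exact: D_br.
have [l E] := abelian_ideal_scalar hom irr IH Dxy.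
have : \tr (rho (br x y)) = 0.
  by rewrite (hom _ _ (D_sub Dx) (D_sub Dy)) linearB /= mxtrace_mulC subrr.
rewrite E mxtrace_scalar => /eqP; rewrite mulrn_eq0 /= => /eqP ->.
by rewrite raddf0.
Qed.

(** Induction on the dimension. In the irreducible case [rho y] is a nilpotent scalar, hence zero;
    otherwise the trace is the sum of those on a proper nonzero subrepresentation and on its
    quotient. *)
Lemma trace_mul_nilpotent n (rho : T -> 'M[F]_n) :
  bracket_morphism rho -> (forall x, D k x -> rho x = 0) ->
  forall x y, D 0%N x -> D 0%N y -> (exists m, rho y ^+ m = 0) ->
  \tr (rho x *m rho y) = 0.
Proof.
have [m] := ubnP n; elim: m => // m IH in n rho *; rewrite ltnS => nm.
move=> hom Dk0 x y Dx Dy nily.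
have [irr|red] := pselect (irreducible_rep rho).
  case: n => [|n] in rho nm hom Dk0 nily irr *; first by rewrite /mxtrace big_ord0.
  have [l yE] := irreducible_scalar hom irr Dk0 Dy.
  case: nily => j; rewrite yE -rmorphXn /= => /eqP.
  rewrite fmorph_eq0 expf_eq0 => /andP[_ /eqP ->].
  by rewrite raddf0 mulmx0 mxtrace0.
move/existsNP: red => [U /not_implyP[sU /not_orP[U0 Un]]].
have [P1 [Q1 [P2 [Q2 [PU QP PQ1 PQ2 P1Q2]]]]] := complementary_projections U.
have stab z : D 0%N z -> P1 *m rho z *m Q2 = 0.
  move=> Dz; have /submxP[C E] : (P1 *m rho z <= P1)%MS.
    by rewrite PU (eqmxMr (rho z) PU) sU.
  by rewrite E -mulmxA P1Q2 mulmx0.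
have insert r s (A : 'M_(r, n)) (B : 'M_(n, s)) :
    A *m B = A *m Q1 *m (P1 *m B) + A *m Q2 *m (P2 *m B).
  by rewrite -[A in LHS]mulmx1 -QP mulmxDr mulmxDl !mulmxA.
(* [rho1] is the restriction to [U] and [rho2] the quotient. Compression to either block is
   multiplicative because the off-diagonal block in [stab] vanishes; [A] is kept arbitrary below so
   that powers and brackets are covered as well as products. *)
pose rho1 z := P1 *m rho z *m Q1; pose rho2 z := P2 *m rho z *m Q2.
have mul1 z A : D 0%N z -> rho1 z *m (P1 *m A *m Q1) = P1 *m (rho z *m A) *m Q1.
  move=> Dz; rewrite [in RHS]mulmxA -[in RHS]mulmxA [in RHS]insert stab // mul0mx addr0.
  by rewrite !mulmxA.
have mul2 z A : D 0%N z -> P2 *m A *m Q2 *m rho2 z = P2 *m (A *m rho z) *m Q2.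
  move=> Dz; rewrite [in RHS]mulmxA -[in RHS]mulmxA [in RHS]insert.
  by rewrite [P1 *m (_ *m _)]mulmxA stab // mulmx0 add0r /rho2 !mulmxA.
have pow1 z j : D 0%N z -> rho1 z ^+ j = P1 *m rho z ^+ j *m Q1.
  move=> Dz; elim: j => [|j IHj]; first by rewrite !expr0 mulmx1 PQ1.
  by rewrite !exprS IHj; exact: mul1.
have pow2 z j : D 0%N z -> rho2 z ^+ j = P2 *m rho z ^+ j *m Q2.
  move=> Dz; elim: j => [|j IHj]; first by rewrite !expr0 mulmx1 PQ2.
  by rewrite !exprSr IHj; exact: mul2.
have -> : \tr (rho x *m rho y) = \tr (rho1 x *m rho1 y) + \tr (rho2 x *m rho2 y).
  rewrite mul1 // mul2 // [in RHS]mxtrace_mulC [X in _ + X]mxtrace_mulC !mulmxA.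
  by rewrite -mxtraceD -!mulmxDl QP mul1mx.
have [r1 r2] : (\rank U < m)%N /\ (\rank U^C < m)%N.
  rewrite mxrank_compl; have := rank_leq_col U; have : (0 < \rank U)%N.
    by rewrite lt0n mxrank_eq0; apply/eqP.
  by move: nm Un; lia.
case: nily => j yj; rewrite !IH ?addr0 //.
- by move=> z w Dz Dw; rewrite [LHS]/rho2 hom // mulmxBr mulmxBl -!mul2.
- by move=> z Dz; rewrite /rho2 Dk0 // mulmx0 mul0mx.
- by exists j; rewrite pow2 // yj mulmx0 mul0mx.
- by move=> z w Dz Dw; rewrite [LHS]/rho1 hom // mulmxBr mulmxBl -!mul1.
- by move=> z Dz; rewrite /rho1 Dk0 // mulmx0 mul0mx.
- by exists j; rewrite pow1 // yj mulmx0 mul0mx.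
Qed.

End LieTrace.

Lemma eventually_ord n (P : 'I_n -> nat -> Prop) :
  (forall i, exists N, forall M : nat, (N <= M)%N -> P i M) ->
  exists N, forall i M, (N <= M)%N -> P i M.
Proof.
case/choice=> N NP; exists (\max_i N i)%N => i M NM.
by apply: NP; apply: leq_trans NM; exact: leq_bigmax.
Qed.

(** * Lie algebras of endomorphisms *)

Section Endo.
Variables (F : numClosedFieldType) (V : lmodType F).
Implicit Types (X Y Z : endo V) (L M G I p : endo V -> Prop).

Definition linear_endo X : Prop :=
  forall a u v, X (a *: u + v) = a *: X u + X v.

Lemma linear_endo0 X : linear_endo X -> X 0 = 0.
Proof.
by move=> linX; have := linX (-1) 0 0; rewrite scaler0 addr0 scaleN1r addNr.
Qed.

Lemma linear_endoD X : linear_endo X -> forall u v, X (u + v) = X u + X v.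
Proof. by move=> linX u v; have := linX 1 u v; rewrite !scale1r. Qed.

Lemma linear_endoZ X : linear_endo X -> forall a u, X (a *: u) = a *: X u.
Proof. by move=> linX a u; have := linX a u 0; rewrite (linear_endo0 linX) !addr0. Qed.

Lemma linear_endoB X : linear_endo X -> forall u v, X (u - v) = X u - X v.
Proof.
by move=> linX u v; rewrite (linear_endoD linX) -scaleN1r (linear_endoZ linX) scaleN1r.
Qed.

Lemma bracketDl X X' Y : linear_endo Y ->
  bracket (fun v => X v + X' v) Y = (fun v => bracket X Y v + bracket X' Y v).
Proof.
move=> linY; apply/funext=> v.
by rewrite /bracket (linear_endoD linY) opprD addrACA.
Qed.

Lemma bracketDr X Y Y' : linear_endo X ->
  bracket X (fun v => Y v + Y' v) = (fun v => bracket X Y v + bracket X Y' v).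
Proof.
move=> linX; apply/funext=> v.
by rewrite /bracket (linear_endoD linX) opprD addrACA.
Qed.

Lemma bracketZl a X Y : linear_endo Y ->
  bracket (fun v => a *: X v) Y = (fun v => a *: bracket X Y v).
Proof.
by move=> linY; apply/funext=> v; rewrite /bracket (linear_endoZ linY) scalerBr.
Qed.

Lemma bracket0l Y : linear_endo Y -> bracket (fun=> 0) Y = (fun=> 0).
Proof.
by move=> linY; apply/funext=> v; rewrite /bracket (linear_endo0 linY) subrr.
Qed.

Lemma bracketC X Y : bracket X Y = (fun v => -1 *: bracket Y X v).
Proof. by apply/funext=> v; rewrite /bracket scaleN1r opprB. Qed.

Lemma bracket_jacobi X Y Z :
  linear_endo X -> linear_endo Y -> linear_endo Z ->
  bracket (bracket X Y) Z =
  (fun v => bracket (bracket X Z) Y v + bracket X (bracket Y Z) v).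
Proof.
move=> linX linY linZ; apply/funext=> v; rewrite /bracket.
rewrite !(linear_endoB linX) !(linear_endoB linY) !(linear_endoB linZ).
(* Of the eight terms on the right, the first cancels the sixth and the third the eighth; the other
   four form the left side. *)
rewrite !opprB !addrA [RHS](ACl (5*4*7*2*(1*6)*(3*8)))/=.
by rewrite !subrr !addr0.
Qed.

(** * Derived series *)

Lemma derived_subspace L : is_subspace (derived L).
Proof.
split; first by move=> M [].
split=> [X Y LX LY M sM ML|a X LX M sM ML].
  by apply: sM.2.1; [exact: LX|exact: LY].
by apply: sM.2.2; exact: LX.
Qed.

Lemma derived_bracket L X Y : L X -> L Y -> derived L (bracket X Y).
Proof. by move=> LX LY M _; apply. Qed.

Lemma derived_mono L L' : (forall X, L X -> L' X) ->
  forall X, derived L X -> derived L' X.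
Proof. by move=> LL X LX M sM ML; apply: LX => // a b /LL ? /LL ?; exact: ML. Qed.

Lemma derser_mono L L' k : (forall X, L X -> L' X) ->
  forall X, derser L k X -> derser L' k X.
Proof. by move=> LL; elim: k => // k IH; exact: derived_mono. Qed.

Lemma derser_subspace L k : is_subspace L -> is_subspace (derser L k).
Proof. by case: k => // k _; exact: derived_subspace. Qed.

Lemma derserD L m k : derser L (m + k) = derser (derser L k) m.
Proof. by elim: m => //= m ->. Qed.

Section LinearLie.
Variable L : endo V -> Prop.
Hypothesis linL : forall X, L X -> linear_endo X.
Hypothesis subL : is_subspace L.
Hypothesis brL : forall X Y, L X -> L Y -> L (bracket X Y).

Lemma derser_sub k X : derser L k X -> L X.
Proof.
elim: k X => // k IH X; apply=> // a b /IH La /IH Lb; exact: brL.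
Qed.

(** Bracketing with [Y] is a derivation by the Jacobi identity, so if it preserves a term of the
    series it preserves the next one. *)
Lemma derser_ideal k X Y : derser L k X -> L Y -> derser L k (bracket X Y).
Proof.
move=> + LY; elim: k X => [|k IH] X; first by move=> LX; exact: brL.
have [d0 [dD dZ]] := derived_subspace (derser L k).
have linY := linL LY.
move=> LX.
(* [derived] is an intersection of subspaces, so induction on it means instantiating the subspace
   with the property to be proved. *)
apply: (LX (fun X => derser L k.+1 (bracket X Y))) => [|a b La Lb].
  split; first by rewrite bracket0l.
  by split=> *; [rewrite bracketDl //; apply: dD|rewrite bracketZl //; apply: dZ].
rewrite bracket_jacobi //; first last.
- exact/linL/(derser_sub Lb).
- exact/linL/(derser_sub La).
by apply: dD; apply: derived_bracket => //; exact: IH.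
Qed.
End LinearLie.

(** * Sums of a subalgebra and an ideal *)

Definition sum_endo G I Z : Prop :=
  exists X Y, [/\ G X, I Y & Z = (fun v => X v + Y v)].

Lemma sum_subspace G I : is_subspace G -> is_subspace I ->
  is_subspace (sum_endo G I).
Proof.
move=> [G0 [GD GZ]] [I0 [ID IZ]]; split.
  by exists (fun=> 0), (fun=> 0); split=> //; apply/funext=> v; rewrite addr0.
split=> [_ _ [X [Y [GX IY ->]]] [X' [Y' [GX' IY' ->]]]|a _ [X [Y [GX IY ->]]]].
  exists (fun v => X v + X' v), (fun v => Y v + Y' v); split; auto.
  by apply/funext=> v; rewrite addrACA.
exists (fun v => a *: X v), (fun v => a *: Y v); split; auto.
by apply/funext=> v; rewrite scalerDr.
Qed.

Section Ideal.
Variables p I : endo V -> Prop.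
Hypothesis linp : forall X, p X -> linear_endo X.
Hypothesis idI : is_ideal p I.

(** Modulo [I] the bracket depends only on the components in [G]: the three other terms of the
    expansion lie in the ideal. *)
Lemma bracket_sum G X X' Y Y' :
  (forall Z, G Z -> p Z) -> G X -> G X' -> I Y -> I Y' ->
  exists2 Z, I Z & bracket (fun v => X v + Y v) (fun v => X' v + Y' v) =
                   (fun v => bracket X X' v + Z v).
Proof.
case: idI => [[I0 [ID IZ]] [Ip Ibr]] Gp GX GX' IY IY'.
have linX := linp (Gp _ GX); have linX' := linp (Gp _ GX').
have linY := linp (Ip _ IY); have linY' := linp (Ip _ IY').
have lin' : linear_endo (fun v => X' v + Y' v).
  by move=> a u v; rewrite linX' linY' scalerDr addrACA.
exists (fun v => bracket X Y' v + (bracket Y X' v + bracket Y Y' v)).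
  apply: (ID); first by apply: (Ibr) => //; exact: Gp.
  apply: (ID); last by apply: (Ibr) => //; exact: Ip.
  by rewrite bracketC; apply: IZ; apply: Ibr => //; exact: Gp.
rewrite bracketDl // !bracketDr //.
by apply/funext=> v; rewrite !addrA.
Qed.

(** Leaving [L] arbitrary lets this be iterated: each term of the derived series of a subalgebra of
    [G + I] lies in the same term for [G], plus [I]. *)
Lemma derived_sum L G : (forall X, G X -> p X) ->
  (forall X, L X -> sum_endo G I X) ->
  forall X, derived L X -> sum_endo (derived G) I X.
Proof.
move=> Gp LG X; apply.
  by apply: sum_subspace idI.1; exact: derived_subspace.
move=> a b /LG[x [y [Gx Iy ->]]] /LG[x' [y' [Gx' Iy' ->]]].
have [Z IZ ->] := bracket_sum Gp Gx Gx' Iy Iy'.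
by exists (bracket x x'), Z; split=> //; exact: derived_bracket.
Qed.
End Ideal.

End Endo.

(** * Pairings, finite-rank endomorphisms and generated subalgebras *)

Section Pairing.
Variables (F : numClosedFieldType) (V Vs : lmodType F) (pr : V -> Vs -> F).
Hypothesis bil : bilinear_pairing pr.
Implicit Types (X Y Z : endo V) (L M G I p : endo V -> Prop).

Lemma pairing0l w : pr 0 w = 0.
Proof. by have := bil.1 (-1) 0 0 w; rewrite scaler0 addr0 mulN1r addNr. Qed.

Lemma pairingDl u v w : pr (u + v) w = pr u w + pr v w.
Proof. by have := bil.1 1 u v w; rewrite scale1r mul1r. Qed.

Lemma pairingZl a v w : pr (a *: v) w = a * pr v w.
Proof. by have := bil.1 a v 0 w; rewrite !addr0 pairing0l addr0. Qed.

Lemma pairing_suml n (v : 'I_n -> V) w :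
  pr (\sum_i v i) w = \sum_i pr (v i) w.
Proof.
by apply: (big_morph (pr^~ w)) => [u u'|]; [exact: pairingDl|exact: pairing0l].
Qed.

Lemma pairing0r v : pr v 0 = 0.
Proof. by have := bil.2 (-1) v 0 0; rewrite scaler0 addr0 mulN1r addNr. Qed.

Lemma pairingDr v w w' : pr v (w + w') = pr v w + pr v w'.
Proof. by have := bil.2 1 v w w'; rewrite scale1r mul1r. Qed.

Lemma pairingZr a v w : pr v (a *: w) = a * pr v w.
Proof. by have := bil.2 a v w 0; rewrite !addr0 pairing0r addr0. Qed.

Lemma pairing_sumr n v (w : 'I_n -> Vs) :
  pr v (\sum_i w i) = \sum_i pr v (w i).
Proof.
by apply: (big_morph (pr v)) => [u u'|]; [exact: pairingDr|exact: pairing0r].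
Qed.

Lemma in_gl_linear X : in_gl pr X -> linear_endo X.
Proof.
move=> [n [v [w XE]]] a x y; rewrite !XE scaler_sumr -big_split /=.
by apply: eq_bigr => i _; rewrite bil.1 scalerDl scalerA.
Qed.

Lemma in_gl_comp X Y : in_gl pr X -> in_gl pr Y -> in_gl pr (Defs.comp X Y).
Proof.
move=> [n [v [w XE]]] [m [v' [w' YE]]].
exists n, v, (fun i => \sum_j pr (v' j) (w i) *: w' j) => x.
rewrite /Defs.comp XE; apply: eq_bigr => i _; congr (_ *: _).
rewrite YE pairing_suml pairing_sumr; apply: eq_bigr => j _.
by rewrite pairingZl pairingZr mulrC.
Qed.

Lemma gen_subalg_subset n (f : 'I_n -> endo V) M :
  is_subalgebra pr M -> (forall i, M (f i)) ->
  forall X, gen_subalg pr f X -> M X.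
Proof. by move=> sM Mf X; apply. Qed.

Lemma gen_subalg_mem n (f : 'I_n -> endo V) i : gen_subalg pr f (f i).
Proof. by move=> M _; apply. Qed.

(** The ambient [B] ensures that the intersection defining [gen_subalg] is over a nonempty family,
    so that its elements have finite rank. *)
Lemma gen_subalgP n (f : 'I_n -> endo V) B :
  is_subalgebra pr B -> (forall i, B (f i)) ->
  is_subalgebra pr (gen_subalg pr f).
Proof.
move=> sB Bf; split; first by move=> X; move/(_ B sB Bf); exact: sB.1.
split; last by move=> X Y LX LY M sM Mf; apply: sM.2.2; [exact: LX|exact: LY].
split; first by move=> M sM _; exact: sM.2.1.1.
split=> [X Y LX LY M sM Mf|a X LX M sM Mf].
  by apply: sM.2.1.2.1; [exact: LX|exact: LY].
by apply: sM.2.1.2.2; exact: LX.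
Qed.

Lemma sum_subalgebra p G I : is_subalgebra pr p -> is_ideal p I ->
  is_subalgebra pr G -> (forall X, G X -> p X) ->
  is_subalgebra pr (sum_endo G I) /\ (forall X, sum_endo G I X -> p X).
Proof.
move=> sp idI sG Gp.
have linp X : p X -> linear_endo X by move/sp.1; exact: in_gl_linear.
have sub X : sum_endo G I X -> p X.
  by move=> [x [y [/Gp px /idI.2.1 py ->]]]; exact: sp.2.1.2.1.
split=> //; split; first by move=> X /sub; exact: sp.1.
split; first by apply: sum_subspace sG.2.1 idI.1.
move=> _ _ [x [y [Gx Iy ->]]] [x' [y' [Gx' Iy' ->]]].
have [Z IZ ->] := bracket_sum linp idI Gp Gx Gx' Iy Iy'.
by exists (bracket x x'), Z; split=> //; exact: sG.2.2.
Qed.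

Lemma ideal_subalgebra p I :
  is_subalgebra pr p -> is_ideal p I -> is_subalgebra pr I.
Proof.
move=> sp [sI [Ip Ibr]]; split; first by move=> X /Ip; exact: sp.1.
by split=> // X Y /Ip pX IY; exact: Ibr.
Qed.

(** * Coordinates and local finiteness *)

Section Coordinates.
Variables (e : nat -> V) (e' : nat -> Vs) (N : nat).

Definition vec (a : 'cV[F]_N) : V := \sum_i a i 0 *: e i.
Definition covec (x : V) : 'cV[F]_N := \col_j pr x (e' j).
(** The tensor with coefficients [c i j] on [e i] and [e' j]; the two bases are not assumed dual. *)
Definition endo_of (c : 'M[F]_N) : endo V := fun x => vec (c *m covec x).
(** This constrains [X] only on the span of the first [N] vectors, which it requires to be
    stable. *)
Definition represents (X : endo V) (M : 'M[F]_N) : Prop :=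
  forall a, X (vec a) = vec (M *m a).

Lemma vec_linear k a b : vec (k *: a + b) = k *: vec a + vec b.
Proof.
rewrite /vec scaler_sumr -big_split /=; apply: eq_bigr => i _.
by rewrite !mxE scalerDl scalerA.
Qed.

Lemma vec0 : vec 0 = 0.
Proof. by rewrite /vec big1 // => i _; rewrite mxE scale0r. Qed.

Lemma vecD a b : vec (a + b) = vec a + vec b.
Proof. by have := vec_linear 1 a b; rewrite !scale1r. Qed.

Lemma vecZ k a : vec (k *: a) = k *: vec a.
Proof. by have := vec_linear k a 0; rewrite vec0 !addr0. Qed.

Lemma vec_sum n (h : 'I_n -> 'cV[F]_N) : vec (\sum_i h i) = \sum_i vec (h i).
Proof. by apply: (big_morph vec); [exact: vecD|exact: vec0]. Qed.

Lemma vecB a b : vec (a - b) = vec a - vec b.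
Proof. by rewrite vecD -[- b]scaleN1r vecZ scaleN1r. Qed.

(** Writing the scalar as the trace of a 1 by 1 matrix makes cyclicity of the trace available in
    [trace_represents]. *)
Lemma pairing_vec a w : pr (vec a) w = \tr ((\row_i pr (e i) w) *m a).
Proof.
rewrite /vec pairing_suml /mxtrace big_ord1 mxE; apply: eq_bigr => i _.
by rewrite pairingZl mxE mulrC.
Qed.

Lemma covec_vec a : covec (vec a) = (\matrix_(j, i) pr (e i) (e' j)) *m a.
Proof.
apply/colP=> j; rewrite !mxE /vec pairing_suml; apply: eq_bigr => i _.
by rewrite pairingZl mxE mulrC.
Qed.

Lemma endo_of_linear k c d :
  endo_of (k *: c + d) = (fun x => k *: endo_of c x + endo_of d x).
Proof. by apply/funext=> x; rewrite /endo_of mulmxDl -scalemxAl vec_linear. Qed.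

Lemma endo_of0 : endo_of 0 = (fun=> 0).
Proof. by apply/funext=> x; rewrite /endo_of mul0mx vec0. Qed.

Lemma represents_endo_of c :
  represents (endo_of c) (c *m \matrix_(j, i) pr (e i) (e' j)).
Proof. by move=> a; rewrite /endo_of covec_vec mulmxA. Qed.

(** Tensors multiply through the Gram matrix of the pairing, so those on the first [N] vectors and
    covectors form a finite-dimensional algebra. This is the local finiteness used later. *)
Lemma bracket_endo_of c d :
  exists c', bracket (endo_of c) (endo_of d) = endo_of c'.
Proof.
pose Gm : 'M_N := \matrix_(j, i) pr (e i) (e' j).
have mulE a b x : endo_of a (endo_of b x) = endo_of (a *m Gm *m b) x.
  by rewrite {2}/endo_of represents_endo_of /endo_of !mulmxA.
exists (c *m Gm *m d - d *m Gm *m c); apply/funext=> x.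
by rewrite /bracket !mulE /endo_of mulmxBl vecB.
Qed.

Lemma endo_of_subspace : is_subspace (fun X => exists c, X = endo_of c).
Proof.
split; first by exists 0; rewrite endo_of0.
split=> [_ _ [c ->] [d ->]|k _ [c ->]].
  by exists (1 *: c + d); rewrite endo_of_linear; apply/funext=> x; rewrite scale1r.
by exists (k *: c + 0); rewrite endo_of_linear endo_of0; apply/funext=> x; rewrite addr0.
Qed.

Lemma endo_of_subalgebra B : is_subalgebra pr B ->
  is_subalgebra pr (fun X => B X /\ exists c, X = endo_of c).
Proof.
move=> [Bgl [[B0 [BD BZ]] Bbr]]; have [E0 [ED EZ]] := endo_of_subspace.
split; first by move=> X [/Bgl].
split; last first.
  move=> X Y [BX [c XE]] [BY [d YE]]; split; first exact: Bbr.
  by rewrite XE YE; exact: bracket_endo_of.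
by split=> //; split=> [X Y [BX EX] [BY EY]|k X [BX EX]]; split; auto.
Qed.

(* That [g] spans [L] is expressed through the subspaces containing [g]. *)
Lemma finite_span L : is_subspace L ->
  (forall X, L X -> exists c, X = endo_of c) ->
  exists (n : nat) (g : 'I_n -> endo V), (forall i, L (g i)) /\
    forall M, is_subspace M -> (forall i, M (g i)) -> forall X, L X -> M X.
Proof.
move=> sL Lc.
(* Flattening matrices to rows turns the part of any subspace [M] inside the truncation into a row
   space, so inclusions become comparisons of row spaces. *)
have span (M : endo V -> Prop) : is_subspace M ->
    exists U : 'M_(N * N), forall v, M (endo_of (vec_mx v)) <-> (v <= U)%MS.
  move=> [M0 [MD MZ]]; apply: subspace_mx; first by rewrite linear0 endo_of0.
  by move=> k u v Mu Mv; rewrite linearP endo_of_linear; apply: MD => //; exact: MZ.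
have [U UP] := span L sL.
exists (N * N)%N, (fun i => endo_of (vec_mx (row i U))); split.
  by move=> i; apply/UP; exact: row_sub.
move=> M sM Mg X LX; have [U' UP'] := span M sM.
have UU' : (U <= U')%MS by apply/row_subP=> i; apply/UP'; exact: Mg.
have [c XE] := Lc X LX; rewrite XE -[c]mxvecK; apply/UP'.
by apply: submx_trans UU'; apply/UP; rewrite mxvecK -XE.
Qed.

Hypothesis indep : forall c : nat -> F,
  \sum_(i < N) c i *: e i = 0 -> forall i, (i < N)%N -> c i = 0.

Lemma vec_eq0 a : vec a = 0 -> a = 0.
Proof.
move=> a0; apply/colP=> i; rewrite mxE.
(* The hypothesis [indep] concerns sequences on [nat], so [a] is extended by zero. *)
pose c j := if insub j is Some k then a k 0 else 0 : F.
have cE (k : 'I_N) : c k = a k 0 by rewrite /c valK.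
rewrite -cE; apply: indep => //.
by rewrite -[RHS]a0; apply: eq_bigr => k _; rewrite cE.
Qed.

Lemma represents_inj X A B : represents X A -> represents X B -> A = B.
Proof.
move=> XA XB; apply/matrixP=> i j.
suff /colP/(_ i) : col j A = col j B by rewrite !mxE.
apply/eqP; rewrite !colE -subr_eq0.
by apply/eqP/vec_eq0; rewrite vecB -XA -XB subrr.
Qed.

Lemma represents_comp X Y A B : represents X A -> represents Y B ->
  represents (Defs.comp X Y) (A *m B).
Proof. by move=> XA YB a; rewrite /Defs.comp YB XA mulmxA. Qed.

Lemma represents_bracket X Y A B : represents X A -> represents Y B ->
  represents (bracket X Y) (A *m B - B *m A).
Proof.
by move=> XA YB a; rewrite /bracket XA YB XA YB mulmxBl vecB !mulmxA.
Qed.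

Lemma represents_nilpotent X A :
  represents X A -> nilpotent_endo X -> exists m, A ^+ m = 0.
Proof.
move=> XA [m Xm]; exists m.
apply: (@represents_inj (fun=> 0)); last by move=> a; rewrite mul0mx vec0.
move=> a; rewrite -(Xm (vec a)).
elim: m a {Xm} => [|m IH] a; first by rewrite expr0 mul1mx.
by rewrite iterS IH XA exprS mulmxA.
Qed.

(** Each tensor becomes a column times a row, whose trace is the pairing of its factors. Any
    decomposition with vectors in the span gives the same value, so the unknown one behind [tr] can
    be evaluated. *)
Lemma trace_represents X A n (v : 'I_n -> V) (w : 'I_n -> Vs) :
  represents X A -> (forall x, X x = \sum_i pr x (w i) *: v i) ->
  (forall i, exists b, v i = vec b) -> \sum_i pr (v i) (w i) = \tr A.
Proof.
move=> XA XE /choice[b vE].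
have -> : A = \sum_i b i *m \row_k pr (e k) (w i).
  apply: (represents_inj XA) => a; rewrite XE mulmx_suml.
  rewrite vec_sum; apply: eq_bigr => i _.
  rewrite -mulmxA [_ *m a]mx11_scalar mul_mx_scalar vE pairing_vec /mxtrace big_ord1.
  by rewrite vecZ.
rewrite raddf_sum; apply: eq_bigr => i _.
by rewrite vE pairing_vec /= mxtrace_mulC.
Qed.

(** By [gen_subalg_subset], it follows that everything generated by represented elements is
    represented. *)
Lemma represented_subalgebra B : is_subalgebra pr B ->
  is_subalgebra pr (fun X => B X /\ exists A, represents X A).
Proof.
move=> [Bgl [[B0 [BD BZ]] Bbr]]; split; first by move=> X [/Bgl].
split; last first.
  move=> X Y [BX [A XA]] [BY [C YC]]; split; first exact: Bbr.
  by exists (A *m C - C *m A); exact: represents_bracket.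
split; first by split=> //; exists 0 => a; rewrite mul0mx vec0.
split=> [X Y [BX [A XA]] [BY [C YC]]|k X [BX [A XA]]].
  split; first exact: BD.
  by exists (A + C) => a; rewrite mulmxDl vecD XA YC.
split; first exact: BZ.
by exists (k *: A) => a; rewrite -scalemxAl vecZ XA.
Qed.

End Coordinates.

(** * Exhaustion by finite-dimensional truncations *)

Lemma vec_widen (U : lmodType F) (e : nat -> U) n (c : nat -> F) N :
  (n <= N)%N -> exists c' : 'I_N -> F, \sum_(i < n) c i *: e i = \sum_(i < N) c' i *: e i.
Proof.
move=> nN; exists (fun i => if (i < n)%N then c i else 0).
rewrite (big_ord_widen N (fun i => c i *: e i) nN) big_mkcond.
by apply: eq_bigr => i _; case: ifP => // _; rewrite scale0r.
Qed.

Lemma eventually_vec (e : nat -> V) :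
  (forall u, exists n (c : nat -> F), u = \sum_(i < n) c i *: e i) ->
  forall u, exists N, forall M : nat, (N <= M)%N -> exists a, u = vec e (a : 'cV_M).
Proof.
move=> gen u; have [n [c ->]] := gen u; exists n => M nM.
have [c' ->] := vec_widen e c nM; exists (\col_i c' i).
by apply: eq_bigr => i _; rewrite mxE.
Qed.

Lemma eventually_endo_of (e : nat -> V) (e' : nat -> Vs) :
  (forall u, exists n (c : nat -> F), u = \sum_(i < n) c i *: e i) ->
  (forall u, exists n (c : nat -> F), u = \sum_(i < n) c i *: e' i) ->
  forall X, in_gl pr X ->
  exists N, forall M : nat, (N <= M)%N -> exists c : 'M_M, X = endo_of e e' c.
Proof.
move=> gen gen' X [n [v [w XE]]].
have /eventually_ord[N1 N1P] i := eventually_vec gen (v i).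
have /eventually_ord[N2 N2P] : forall i, exists N, forall M : nat, (N <= M)%N ->
    exists c' : 'I_M -> F, w i = \sum_(j < M) c' j *: e' j.
  move=> i; have [m [c ->]] := gen' (w i); exists m => M mM.
  exact: vec_widen.
exists (maxn N1 N2) => M; rewrite geq_max => /andP[NM1 NM2].
have /choice[a vE] i := N1P i M NM1; have /choice[b wE] i := N2P i M NM2.
exists (\sum_i a i *m \row_j b i j); apply/funext=> x.
rewrite XE /endo_of mulmx_suml vec_sum.
apply: eq_bigr => i _.
rewrite -mulmxA [_ *m covec _ _ _]mx11_scalar mul_mx_scalar vE.
rewrite vecZ mxE; congr (_ *: _).
by rewrite wE pairing_sumr; apply: eq_bigr => j _; rewrite pairingZr !mxE.
Qed.

(** On the span of sufficiently many basis vectors, the solvable algebra generated by [X] and [Y]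
    has a matrix representation computing [tr], so [trace_mul_nilpotent] applies. *)
Lemma tr_mul_nilpotent B X Y : countable_dim V -> countable_dim Vs ->
  is_subalgebra pr B -> locally_solvable pr B -> B X -> B Y ->
  nilpotent_endo Y -> tr pr (Defs.comp X Y) = 0.
Proof.
move=> [e [indep gen]] [e' [_ gen']] sB solB BX BY nilY.
have glX := sB.1 _ BX; have glY := sB.1 _ BY.
(* [tr] is a choice, so some decomposition must be exhibited before one realizing the chosen value
   can be extracted. *)
have : has_trace pr (Defs.comp X Y) (tr pr (Defs.comp X Y)).
  have [n [v [w XE]]] := in_gl_comp glX glY.
  apply: ClassicalEpsilon.epsilon_spec.
  by exists (\sum_i pr (v i) (w i)), n, v, w.
case=> n [v [w [XYE ->]]].
have /eventually_ord[N1 N1P] i := eventually_vec gen (v i).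
have [N2 N2P] := eventually_endo_of gen gen' glX.
have [N3 N3P] := eventually_endo_of gen gen' glY.
pose N := (N1 + N2 + N3)%N.
have [cX XE] := N2P N ltac:(lia); have [cY YE] := N3P N ltac:(lia).
have indepN := indep N.
pose f (i : 'I_2) := if i == 0 then X else Y.
have Bf i : B (f i) by rewrite /f; case: ifP.
pose L := gen_subalg pr f.
have sL : is_subalgebra pr L by exact: gen_subalgP sB Bf.
have linL Z : L Z -> linear_endo Z by move/sL.1; exact: in_gl_linear.
have [k Lk] := solB 2 f Bf.
have repL Z : L Z -> exists A : 'M_N, represents e Z A.
  have repf i : B (f i) /\ exists A : 'M_N, represents e (f i) A.
    split=> //; rewrite /f; case: ifP => _.
      by rewrite XE; eexists; exact: represents_endo_of.
    by rewrite YE; eexists; exact: represents_endo_of.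
  by move=> /(gen_subalg_subset (represented_subalgebra e N sB) repf)[].
(* The matrix is unspecified outside [L]; the representation hypotheses only concern [L]. *)
pose rho Z : 'M_N := ClassicalEpsilon.epsilon (inhabits 0) (represents e Z).
have rhoP Z : L Z -> represents e Z (rho Z).
  by move/repL; exact: ClassicalEpsilon.epsilon_spec.
have LX : L X by exact: (gen_subalg_mem (f := f) 0).
have LY : L Y by exact: (gen_subalg_mem (f := f) 1).
rewrite (trace_represents indepN (represents_comp (rhoP X LX) (rhoP Y LY)) XYE).
  apply: (@trace_mul_nilpotent F (endo V) (@bracket F V) (derser L) k) => //.
  - by move=> i Z W DZ DW; exact: derived_bracket.
  - by move=> i Z W DZ LW; exact: derser_ideal sL.2.1 sL.2.2 _ _ _ DZ LW.
  - by move=> i Z; exact: derser_sub sL.2.1 sL.2.2 _ _.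
  - move=> Z W LZ LW; have LZW := sL.2.2 _ _ LZ LW.
    apply: (represents_inj indepN (rhoP _ LZW)).
    by apply: represents_bracket; exact: rhoP.
  - move=> Z DZ; have LZ := derser_sub sL.2.1 sL.2.2 DZ.
    apply: (represents_inj indepN (rhoP _ LZ)) => a.
    by rewrite (Lk _ DZ) mul0mx vec0.
  - exact: (represents_nilpotent indepN (rhoP Y LY)).
by move=> i; apply: N1P; lia.
Qed.

(** The components in [B] of the generators generate a solvable [G], so some term of the derived
    series of [L] lies in [I]. That term is finite-dimensional, hence contained in a finitely
    generated subalgebra of [I], which is solvable. *)
Lemma sum_locally_solvable p B I : countable_dim V -> countable_dim Vs ->
  is_subalgebra pr p -> is_ideal p I -> is_subalgebra pr B ->
  (forall X, B X -> p X) -> locally_solvable pr B -> locally_solvable pr I ->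
  locally_solvable pr (sum_endo B I).
Proof.
move=> [e [_ gen]] [e' [_ gen']] sp idI sB Bp solB solI n f /choice[xs fP].
have linp X : p X -> linear_endo X by move/sp.1; exact: in_gl_linear.
have [sS Sp] := sum_subalgebra sp idI sB Bp.
have Sf i : sum_endo B I (f i) by have [y] := fP i; exists (xs i), y.
have Bxs i : B (xs i) by have [y []] := fP i.
set L := gen_subalg pr f; pose G := gen_subalg pr xs.
have sL : is_subalgebra pr L by exact: gen_subalgP sS Sf.
have sG : is_subalgebra pr G by exact: gen_subalgP sB Bxs.
have Gp X : G X -> p X by move/(gen_subalg_subset sB Bxs); exact: Bp.
have [k Gk] := solB n xs Bxs.
have LGk j X : derser L j X -> sum_endo (derser G j) I X.
  elim: j X => [|j IH] X /=.
    apply: (gen_subalg_subset (sum_subalgebra sp idI sG Gp).1) => i.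
    have [y [_ Iy fE]] := fP i; exists (xs i), y.
    by split=> //; exact: gen_subalg_mem.
  apply: (derived_sum linp idI) IH _ => Y /(derser_sub sG.2.1 sG.2.2).
  exact: Gp.
have LkI X : derser L k X -> I X.
  move=> /LGk[x [y [/Gk x0 Iy ->]]].
  by rewrite (_ : (fun v => _) = y) //; apply/funext=> v; rewrite x0 add0r.
have glf i : in_gl pr (f i) by apply: sS.1.
have /eventually_ord[N NP] i := eventually_endo_of gen gen' (glf i).
have Lfin X : L X -> exists c : 'M_N, X = endo_of e e' c.
  have Ef i : sum_endo B I (f i) /\ exists c : 'M_N, f i = endo_of e e' c.
    by split=> //; exact: NP.
  by move=> /(gen_subalg_subset (endo_of_subalgebra e e' N sS) Ef)[].
have sLk := derser_subspace k sL.2.1.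
have [|m [g [gL gspan]]] := finite_span sLk (e := e) (e' := e') (N := N).
  by move=> X /(derser_sub sL.2.1 sL.2.2); exact: Lfin.
have gI i : I (g i) by exact: LkI.
have [j gj] := solI m g gI.
(* [k] steps bring [L] into [I], and [j] more kill the subalgebra generated by the spanning family
   [g]. *)
exists (j + k)%N => X; rewrite derserD => DX; apply: gj.
apply: derser_mono DX => Y.
apply: gspan; last by move=> i; exact: (@gen_subalg_mem m g i).
exact: (gen_subalgP (ideal_subalgebra sp idI) gI).2.1.
Qed.

(** * Maximal locally solvable subalgebras *)

Lemma zero_subalgebra : is_subalgebra pr (fun X => X = (fun=> 0)).
Proof.
split=> [_ ->|].
  by exists 0%N, (fun=> 0), (fun=> 0) => x; rewrite big_ord0.
split; last by move=> _ _ -> ->; apply/funext=> x; rewrite /bracket subrr.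
split=> //; split=> [_ _ -> ->|a _ ->]; apply/funext=> x; first by rewrite addr0.
by rewrite scaler0.
Qed.

Lemma zero_locally_solvable : locally_solvable pr (fun X => X = (fun=> 0)).
Proof.
move=> n f f0; exists 0%N => X /(gen_subalg_subset zero_subalgebra f0) -> x.
by [].
Qed.

Lemma chain_common_member (C : (endo V -> Prop) -> Prop) n (f : 'I_n -> endo V) :
  (forall M M', C M -> C M' ->
    (forall X, M X -> M' X) \/ (forall X, M' X -> M X)) ->
  (exists M, C M) -> (forall i, exists2 M, C M & M (f i)) ->
  exists2 M, C M & forall i, M (f i).
Proof.
move=> tot exC; elim: n f => [|n IH] f Cf.
  by case: exC => M CM; exists M => // -[].
have [M CM Mf] := IH (fun i => f (lift ord0 i)) (fun i => Cf _).
have [M' CM' M'f] := Cf ord0.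
have [MM|MM] := tot M M' CM CM'.
  by exists M' => // i; case: (unliftP ord0 i) => [j ->|-> //]; exact: MM.
by exists M => // i; case: (unliftP ord0 i) => [j ->|->] //; exact: MM.
Qed.

(** Being a locally solvable subalgebra is tested on finitely many elements at a time, and these lie
    in one member of a chain; so it passes to unions and Zorn's lemma applies. *)
Lemma maximal_locally_solvable p : is_subalgebra pr p ->
  exists B, [/\ is_subalgebra pr B, locally_solvable pr B,
    forall X, B X -> p X &
    forall B', is_subalgebra pr B' -> locally_solvable pr B' ->
      (forall X, B' X -> p X) -> (forall X, B X -> B' X) ->
      forall X, B' X -> B X].
Proof.
move=> sp.
pose good B := [/\ is_subalgebra pr B, locally_solvable pr B &
  forall X, B X -> p X].
pose P B := (forall X, ~ B X) \/ good B.
have [C CP Ctot|B [PB Bmax]] := @classical_sets.Zorn_bigcup (endo V) P.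
  have [[M0 CM0 [X0 MX0]]|Cempty] := pselect (exists2 M, C M & exists X, M X);
    last by left=> X [M CM MX]; apply: Cempty; exists M => //; exists X.
  right.
  have Cord n (f : 'I_n -> endo V) : (forall i, exists2 M, C M & M (f i)) ->
      exists M, [/\ C M, good M & forall i, M (f i)].
    (* Empty members are discarded so that the common member found is [good], even for an empty
       family. *)
    move=> Cf; pose C' M := C M /\ exists X, M X.
    have [M M' [CM _] [CM' _]|||M [CM [X MX]] Mf] := @chain_common_member C' n f.
    - exact: Ctot.
    - by exists M0; split=> //; exists X0.
    - by move=> i; have [M CM Mf] := Cf i; exists M => //; split=> //; exists (f i).
    - by exists M; split=> //; case: (CP M CM) => // /(_ X).
  have Cord2 X Y : (exists2 M, C M & M X) -> (exists2 M, C M & M Y) ->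
      exists M, [/\ C M, good M, M X & M Y].
    move=> CX CY.
    have [|M [CM gM Mf]] := Cord 2 (fun i => if i == 0 then X else Y).
      by move=> i; case: ifP.
    by exists M; split=> //; [exact: (Mf 0)|exact: (Mf 1)].
  split.
  - split.
      by move=> X CX; have [M [_ [sM _ _] MX _]] := Cord2 X X CX CX; exact: sM.1.
    split; last first.
      move=> X Y CX CY; have [M [CM [sM _ _] MX MY]] := Cord2 X Y CX CY.
      by exists M => //; exact: sM.2.2.
    split.
      have [M [CM [sM _ _] _]] := Cord 0%N (fun=> X0) ltac:(by case).
      by exists M => //; exact: sM.2.1.1.
    split=> [X Y CX CY|a X CX].
      have [M [CM [sM _ _] MX MY]] := Cord2 X Y CX CY.
      by exists M => //; exact: sM.2.1.2.1.
    have [M [CM [sM _ _] MX _]] := Cord2 X X CX CX.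
    by exists M => //; exact: sM.2.1.2.2.
  - by move=> n f /Cord[M [_ [_ solM _] Mf]]; exact: solM.
  - by move=> X CX; have [M [_ [_ _ Mp] MX _]] := Cord2 X X CX CX; exact: Mp.
have gB : good B.
  (* A maximal element is not empty, since the zero subalgebra properly contains the empty
     predicate. *)
  case: PB => // B0; case: (Bmax (fun X => X = (fun=> 0))).
    by split=> [X /B0|/(_ _ erefl)/B0].
  right; split; [exact: zero_subalgebra|exact: zero_locally_solvable|].
  by move=> _ ->; exact: sp.2.1.1.
exists B; case: (gB) => sB solB Bp; split=> // B' sB' solB' B'p BB'.
have [//|nB'B] := pselect (forall X, B' X -> B X).
by case: (Bmax B'); [split|right].
Qed.

End Pairing.

Theorem theorem5p9 (F : numClosedFieldType) (V Vs : lmodType F) (pr : V -> Vs -> F)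
  (hbil : bilinear_pairing pr) (hnd : nondeg_pairing pr)
  (hV : countable_dim V) (hVs : countable_dim Vs)
  (p : endo V -> Prop) (hp : is_subalgebra pr p)
  (horth : forall X, p X <-> orth pr (linear_nilradical pr p) X) :
  is_parabolic pr p.
Proof.
split=> //; have [B [sB solB Bp Bmax]] := maximal_locally_solvable hp.
exists B; split=> //.
have nilB Y : linear_nilradical pr p Y -> B Y.
  move=> [[I [idI [solI IY]]] _].
  have [sS Sp] := sum_subalgebra hbil hp idI sB Bp.
  have solS := sum_locally_solvable hbil hV hVs hp idI sB Bp solB solI.
  apply: (Bmax _ sS solS Sp) => [X BX|].
    exists X, (fun=> 0); split=> //; first exact: idI.1.1.
    by apply/funext=> v; rewrite addr0.
  exists (fun=> 0), Y; split=> //; first exact: sB.2.1.1.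
  by apply/funext=> v; rewrite add0r.
(* [B] is maximal only among subalgebras of [p], so it remains to place [B'] inside [p]. *)
split=> //; split=> // B' sB' solB' BB'; apply: (Bmax B' sB' solB' _ BB').
move=> X B'X; apply/horth; split; first exact: sB'.1.
move=> Y nY; apply: (tr_mul_nilpotent hbil hV hVs sB' solB' B'X _ nY.2).
exact/BB'/nilB.
Qed.
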